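(* Let $(X,d)$ be a complete semimetric space with an upper semicontinuous triangle function $\Phi\colon\mathbb{R}_+^2\to\mathbb{R}_+$ for $d$. Then $(\mathscr{F}(X),D)$ is also complete.
   Context: $\mathbb{R}_+=[0,\infty)$. A semimetric space $(X,d)$ is a nonempty set $X$ with a symmetric function $d:X\times X\to\mathbb{R}_+$ such that $d(x,y)=0$ if and only if $x=y$ (no triangle inequality is assumed). A triangle function for $d$ is a symmetric function $\Phi:\mathbb{R}_+^2\to[0,\infty]$, monotone increasing (in the weak sense) in both arguments, with $\Phi(0,0)=0$ and $d(x,y)\le\Phi(d(x,z),d(z,y))$ for all $x,y,z\in X$; here $\Phi$ is assumed to be finite-valued. A sequence $(x_n)$ converges to $x$ if $d(x_n,x)\to0$; it is Cauchy if for every $\varepsilon>0$ there is $n_0$ with $d(x_n,x_m)<\varepsilon$ for $n,m\ge n_0$; the space is complete if every Cauchy sequence converges to some element of the space. For $p\in X$ and $r\in(0,\infty]$, the ball is $\mathscr{B}(p,r)=\{x\in X: d(x,p)<r\}$. A set $A\subseteq X$ is open if for every $p\in A$ there is $r>0$ with $\mathscr{B}(p,r)\subseteq A$; the open sets form a topology on $X$ (balls need not be open), and closed sets are complements of open sets. The diameter of a set is the supremum of the distances of pairs of its points; a set is bounded if its diameter is finite. $\mathscr{F}(X)$ is the family of all nonempty, closed and bounded subsets of $X$. For nonempty $A,B\subseteq X$ the Hausdorff--Pompeiu distance is $$D(A,B)=\inf\Bigl\{\varepsilon\in(0,\infty]\ \Big|\ A\subseteq\bigcup_{b\in B}\mathscr{B}(b,\varepsilon),\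 B\subseteq\bigcup_{a\in A}\mathscr{B}(a,\varepsilon)\Bigr\}.$$ Under the hypotheses, $D$ restricted to $\mathscr{F}(X)$ is a semimetric, and completeness of $(\mathscr{F}(X),D)$ is understood with respect to it. *)

(* Defs.v *)
From HB Require Import structures.
From mathcomp Require Import all_boot all_order all_algebra.
From mathcomp Require Import all_classical all_reals all_analysis.
Set Implicit Arguments.
Unset Strict Implicit.
Unset Printing Implicit Defensive.
Import Order.TTheory GRing.Theory Num.Theory.
Import numFieldNormedType.Exports.
Local Open Scope classical_set_scope.
Local Open Scope ring_scope.

Record semimetric (R : realType) (X : Type) : Type := Semimetric {
  smdist :> X -> X -> R ;
  semimetric_nonempty : [set: X] !=set0 ;
  smdist_ge0 : forall x y, 0 <= smdist x y ;
  smdistC : forall x y, smdist x y = smdist y x ;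
  smdist_eq0 : forall x y, smdist x y = 0 <-> x = y
}.

(* Only the values of Phi on pairs of nonnegative reals are relevant: a map
   from the quadrant of pairs of nonnegative reals to the nonnegative reals is
   encoded by any extension of it to R -> R -> R. *)
Record triangle_function (R : realType) (X : Type) (d : semimetric R X)
    (Phi : R -> R -> R) : Prop := TriangleFunction {
  triangle_ge0 : forall u v, 0 <= u -> 0 <= v -> 0 <= Phi u v ;
  triangleC : forall u v, 0 <= u -> 0 <= v -> Phi u v = Phi v u ;
  triangle_le : forall u u' v v', 0 <= u -> 0 <= v -> u <= u' -> v <= v' ->
    Phi u v <= Phi u' v' ;
  triangle00 : Phi 0 0 = 0 ;
  triangleP : forall x y z, d x y <= Phi (d x z) (d z y)
}.

(* Upper semicontinuity on the closed quadrant, for its subspace topology. *)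
Definition upper_semicontinuous_quadrant (R : realType) (Phi : R -> R -> R) :=
  forall u v : R, 0 <= u -> 0 <= v -> forall c : R, Phi u v < c ->
    \forall p \near within [set p : R * R | 0 <= p.1 /\ 0 <= p.2] (nbhs (u, v)),
      Phi p.1 p.2 < c.

Definition sm_converges (R : realType) (X : Type) (d : semimetric R X)
    (x_ : nat -> X) (x : X) : Prop :=
  d (x_ n) x @[n --> \oo] --> (0 : R).

Definition sm_cauchy (R : realType) (X : Type) (d : semimetric R X)
    (x_ : nat -> X) : Prop :=
  forall e : R, 0 < e -> exists n0 : nat, forall n m : nat,
    (n0 <= n)%N -> (n0 <= m)%N -> d (x_ n) (x_ m) < e.

Definition sm_complete (R : realType) (X : Type) (d : semimetric R X) : Prop :=
  forall x_ : nat -> X, sm_cauchy d x_ -> exists x : X, sm_converges d x_ x.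

Definition sm_ball (R : realType) (X : Type) (d : semimetric R X)
    (p : X) (r : \bar R) : set X :=
  [set x | ((d x p)%:E < r)%E].

Definition sm_open (R : realType) (X : Type) (d : semimetric R X)
    (A : set X) : Prop :=
  forall p, A p -> exists2 r : \bar R, (0 < r)%E & sm_ball d p r `<=` A.

Definition sm_closed (R : realType) (X : Type) (d : semimetric R X)
    (A : set X) : Prop :=
  sm_open d (~` A).

Definition sm_diameter (R : realType) (X : Type) (d : semimetric R X)
    (A : set X) : \bar R :=
  ereal_sup [set t | exists x y, [/\ A x, A y & t = (d x y)%:E]].

Definition sm_bounded (R : realType) (X : Type) (d : semimetric R X)
    (A : set X) : Prop :=
  (sm_diameter d A < +oo)%E.

Definition closed_bounded (R : realType) (X : Type) (d : semimetric R X) :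
    set (set X) :=
  [set A | [/\ A !=set0, sm_closed d A & sm_bounded d A]].

Definition hausdorff_pompeiu (R : realType) (X : Type) (d : semimetric R X)
    (A B : set X) : \bar R :=
  ereal_inf [set e : \bar R | [/\ (0 < e)%E,
    A `<=` \bigcup_(b in B) sm_ball d b e &
    B `<=` \bigcup_(a in A) sm_ball d a e]].

Section HausdorffPompeiuSemimetric.
Variables (R : realType) (X : Type) (d : semimetric R X) (Phi : R -> R -> R).
Hypothesis tPhi : triangle_function d Phi.

Lemma smdistxx x : d x x = 0. Proof. exact/smdist_eq0. Qed.

Lemma hausdorff_pompeiu_ge0 (A B : set X) : (0 <= hausdorff_pompeiu d A B)%E.
Proof. by apply: le_ereal_inf_tmp => e [e0 _ _]; exact: ltW. Qed.

Lemma hausdorff_pompeiuC (A B : set X) :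
  hausdorff_pompeiu d A B = hausdorff_pompeiu d B A.
Proof.
by rewrite /hausdorff_pompeiu; congr ereal_inf; apply/seteqP;
  split=> e /= [].
Qed.

Lemma sm_bounded_le (A : set X) : sm_bounded d A ->
  exists2 M : R, 0 <= M & forall x y, A x -> A y -> d x y <= M.
Proof.
rewrite /sm_bounded => dA.
have ub x y : A x -> A y -> ((d x y)%:E <= sm_diameter d A)%E.
  by move=> Ax Ay; apply: ereal_sup_ubound; exists x, y.
move: dA ub; case: (sm_diameter d A) => [r| |] //= _ ub.
- exists (Num.max 0 r); first by rewrite le_max lexx.
  by move=> x y Ax Ay; rewrite le_max -[X in _ || X]lee_fin ub ?orbT.
- by exists 0 => // x y Ax Ay; have := ub _ _ Ax Ay.
Qed.

Lemma bounded_bigcup_ball (A B : set X) : A !=set0 -> B !=set0 ->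
  sm_bounded d A -> exists M : R, forall e : R, M < e ->
  A `<=` \bigcup_(b in B) sm_ball d b e%:E.
Proof.
move=> [a0 Aa0] [b0 Bb0] /sm_bounded_le [M M0 AM].
exists (Phi M (d a0 b0)) => e Me a Aa; exists b0 => //.
rewrite /sm_ball /= lte_fin; apply: le_lt_trans Me.
apply: le_trans (triangleP tPhi a b0 a0) _.
by apply: (triangle_le tPhi); rewrite ?smdist_ge0 //; exact: AM.
Qed.

Lemma hausdorff_pompeiu_fin_num (A B : set X) :
  closed_bounded d A -> closed_bounded d B ->
  hausdorff_pompeiu d A B \is a fin_num.
Proof.
move=> [A0 _ bA] [B0 _ bB]; rewrite ge0_fin_numE ?hausdorff_pompeiu_ge0 //.
have [M HM] := bounded_bigcup_ball A0 B0 bA.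
have [N HN] := bounded_bigcup_ball B0 A0 bB.
pose e := Num.max 0 (Num.max M N) + 1.
have [e0 eM eN] : [/\ 0 < e, M < e & N < e].
  by split; rewrite /e ltr_pwDr // !le_max lexx ?orbT.
apply: le_lt_trans (ltry e); apply: ereal_inf_lbound.
by split; [rewrite lte_fin|exact: HM|exact: HN].
Qed.

Lemma hausdorff_pompeiu0_subset (A B : set X) : sm_closed d B ->
  hausdorff_pompeiu d A B = 0%E -> A `<=` B.
Proof.
move=> cB AB0 a Aa; apply: contrapT => /cB[r r0 rB].
have : (hausdorff_pompeiu d A B < r)%E by rewrite AB0.
move=> /ereal_inf_lt[e [_ AB _]] er.
have [b Bb ab] := AB _ Aa.
apply: (rB b _ Bb); rewrite /sm_ball /= smdistC.
exact: lt_trans ab er.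
Qed.

(* [fine] is harmless here: see EFin_hausdorff_dist. *)
Definition hausdorff_dist (A B : closed_bounded d) : R :=
  fine (hausdorff_pompeiu d (val A) (val B)).

Lemma EFin_hausdorff_dist (A B : closed_bounded d) :
  (hausdorff_dist A B)%:E = hausdorff_pompeiu d (val A) (val B).
Proof. exact/fineK/hausdorff_pompeiu_fin_num/set_valP/set_valP. Qed.

Lemma closed_bounded_nonempty : [set: closed_bounded d] !=set0.
Proof.
have [p _] := semimetric_nonempty d.
suff cp : closed_bounded d [set p] by exists (SigSub (mem_set cp)).
split; first by exists p.
- move=> q /= qp; exists (d p q)%:E.
    rewrite lte_fin lt_neqAle smdist_ge0 andbT eq_sym.
    by apply/eqP => /smdist_eq0 pq; exact/qp/esym.
  by move=> x; rewrite /sm_ball /= => + xp; rewrite xp ltxx.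
- apply: (@le_lt_trans _ _ 0%E) => //; apply: ge_ereal_sup => t.
  by move=> [x [y [-> -> ->]]]; rewrite smdistxx.
Qed.

Lemma hausdorff_dist_ge0 (A B : closed_bounded d) : 0 <= hausdorff_dist A B.
Proof. exact/fine_ge0/hausdorff_pompeiu_ge0. Qed.

Lemma hausdorff_distC (A B : closed_bounded d) :
  hausdorff_dist A B = hausdorff_dist B A.
Proof. by rewrite /hausdorff_dist hausdorff_pompeiuC. Qed.

Lemma hausdorff_dist_eq0 (A B : closed_bounded d) :
  hausdorff_dist A B = 0 <-> A = B.
Proof.
split=> [AB0|->].
  have hAB : hausdorff_pompeiu d (val A) (val B) = 0%E.
    by rewrite -EFin_hausdorff_dist AB0.
  have [_ cA _] := set_valP A; have [_ cB _] := set_valP B.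
  apply/val_inj/seteqP; split; first exact: hausdorff_pompeiu0_subset.
  by apply: hausdorff_pompeiu0_subset => //; rewrite hausdorff_pompeiuC.
apply/eqP; rewrite eq_le hausdorff_dist_ge0 andbT.
apply/ler_addgt0Pl => e e0; rewrite addr0 -lee_fin EFin_hausdorff_dist.
have BB : val B `<=` \bigcup_(b in val B) sm_ball d b e%:E.
  by move=> b Bb; exists b => //; rewrite /sm_ball /= smdistxx lte_fin.
by apply: ereal_inf_lbound; split; rewrite ?lte_fin.
Qed.

Definition hausdorff_semimetric : semimetric R (closed_bounded d) :=
  Semimetric closed_bounded_nonempty hausdorff_dist_ge0 hausdorff_distC
    hausdorff_dist_eq0.

End HausdorffPompeiuSemimetric.

(* Main.v *)
Require Import Defs.
From mathcomp Require Import all_boot all_order all_algebra.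
From mathcomp Require Import all_classical all_reals all_analysis.

(**
  At (0, 0), upper semicontinuity of Phi says that d x y is small as soon as
  d x z and d z y are small.  The limit of a Cauchy sequence A_n of closed
  bounded sets is the set of the points x whose balls all meet A_n for n large.
  To see that a point a of A_n, n large, is close to the limit set, choose radii
  r_0 >= r_1 >= ... tending to 0 such that two steps of length r_(k+1) amount to
  less than r_k, and a chain starting at a through sets A_(n_k) whose k-th step
  is shorter than r_(k+2): the triangle inequality then telescopes, the chain is
  Cauchy, and its limit is within r_0 of a.
*)

Set Implicit Arguments.
Unset Strict Implicit.
Unset Printing Implicit Defensive.
Import Order.TTheory GRing.Theory Num.Theory.
Import numFieldNormedType.Exports.
Local Open Scope classical_set_scope.
Local Open Scope ring_scope.

Section SmallTriangles.
Variables (R : realType) (X : Type) (d : semimetric R X).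

(** What upper semicontinuity at the origin leaves once [Phi] is forgotten; it replaces the triangle
    inequality for small distances. *)
Definition small_triangles : Prop := forall e : R, 0 < e ->
  exists2 s : R, 0 < s &
    forall x y z, d x z <= s -> d z y <= s -> d x y < e.

Lemma usc_small_triangles (Phi : R -> R -> R) :
  triangle_function d Phi -> upper_semicontinuous_quadrant Phi ->
  small_triangles.
Proof.
move=> tPhi usc e e0.
have := usc 0 0 (lexx _) (lexx _) e; rewrite (triangle00 tPhi) => /(_ e0).
rewrite near_withinE => /nbhs_ballP[r /= r0 rP].
exists (r / 2); first by rewrite divr_gt0.
have r2 : 0 <= r / 2 by rewrite divr_ge0 // ltW.
(* Monotonicity reduces both distances to the single diagonal point [(r / 2, r / 2)]. *)
move=> x y z xz zy; apply: (@le_lt_trans _ _ (Phi (r / 2) (r / 2))).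
  apply: le_trans (triangleP tPhi x y z) _.
  by apply: (triangle_le tPhi); rewrite ?smdist_ge0.
apply: (rP (r / 2, r / 2)) => //.
have r2r : ball (0 : R) r (r / 2).
  by rewrite /ball /= sub0r normrN ger0_norm // ltr_pdivrMr // ltr_pMr // ltr1n.
by split.
Qed.

Lemma sm_convergesP (x_ : nat -> X) (x : X) : sm_converges d x_ x <->
  forall e : R, 0 < e -> exists N : nat, forall n, (N <= n)%N -> d (x_ n) x < e.
Proof.
split=> [/cvgrPdist_lt cx e e0|xP].
  have [N _ NP] := cx _ e0; exists N => n /NP /=.
  by rewrite sub0r normrN ger0_norm // smdist_ge0.
apply/cvgrPdist_lt => e /xP[N NP]; exists N => // n /NP /=.
by rewrite sub0r normrN ger0_norm // smdist_ge0.
Qed.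

Lemma hausdorff_lt_near (A B : set X) (e : R) (a : X) :
  (hausdorff_pompeiu d A B < e%:E)%E -> A a -> exists2 b, B b & d a b < e.
Proof.
move=> /ereal_inf_lt[t [_ AB _] te] /AB[b Bb abt]; exists b => //.
by rewrite -lte_fin; exact: lt_trans te.
Qed.

Lemma hausdorff_le (A B : set X) (e : R) : 0 < e ->
  (forall a, A a -> exists2 b, B b & d a b < e) ->
  (forall b, B b -> exists2 a, A a & d b a < e) ->
  (hausdorff_pompeiu d A B <= e%:E)%E.
Proof.
move=> e0 AB BA; apply: ereal_inf_lbound; split; first by rewrite lte_fin.
  by move=> a /AB[b Bb ab]; exists b.
by move=> b /BA[a Aa ba]; exists a.
Qed.

Lemma dependent_chain (A : nat -> set X) (r : nat -> R) (a : X) :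
  (forall k x, A k x -> exists2 y, A k.+1 y & d x y < r k) -> A 0%N a ->
  exists x_ : nat -> X, [/\ x_ 0%N = a, forall k, A k (x_ k) &
    forall k, d (x_ k) (x_ k.+1) < r k].
Proof.
move=> step A0a.
have /choice[f fP] (p : nat * X) : exists y, A p.1 p.2 ->
    A p.1.+1 y /\ d p.2 y < r p.1.
  case: p => k x /=; have [/step[y]|nAx] := pselect (A k x).
    by exists y.
  (* A junk value makes the choice total; the chain stays in the sets [A k] and never meets it. *)
  by exists x => /nAx.
pose x_ := fix x_ k := if k is k'.+1 then f (k', x_ k') else a.
have Ax k : A k (x_ k) by elim: k => //= k /(fP (k, _))[].
by exists x_; split => // k; have [] := fP (k, _) (Ax k).
Qed.

(** These radii play the part of [e / 2^k] in a metric space. *)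
Record fast_radii (r : nat -> R) : Prop := FastRadii {
  fast_gt0 : forall k, 0 < r k ;
  fast_decr : forall k, r k.+1 <= r k ;
  fast_inv : forall k, r k.+1 <= k.+1%:R^-1 ;
  fast_triangle : forall k x y z,
    d x z <= r k.+1 -> d z y <= r k.+1 -> d x y < r k
}.

Lemma fast_small (r : nat -> R) : fast_radii r ->
  forall e : R, 0 < e -> exists k, r k < e.
Proof.
move=> fr e e0; have [k] := ltr_add_invr e0.
by rewrite add0r => ke; exists k.+1; apply: le_lt_trans ke; exact: fast_inv.
Qed.

Lemma fast_mono (r : nat -> R) : fast_radii r ->
  forall j k, (j <= k)%N -> r k <= r j.
Proof.
move=> fr j k /subnK <-; elim: (k - j)%N => // m IH.
by rewrite addSn; exact: le_trans (fast_decr fr _) IH.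
Qed.

Lemma exists_fast_radii (e : R) : small_triangles -> 0 < e ->
  exists2 r, fast_radii r & r 0%N = e.
Proof.
move=> st e0.
have /choice[g gP] (p : nat * R) : exists s, 0 < p.2 ->
    [/\ 0 < s, s <= p.2, s <= p.1.+1%:R^-1 &
     forall x y z, d x z <= s -> d z y <= s -> d x y < p.2].
  case: p => k t /=; have [t0|nt0] := ltP 0 t; last by exists t.
  have [s s0 sP] := st _ t0.
  (* The entries of the minimum yield [fast_triangle], [fast_decr] and [fast_inv], in this order. *)
  exists (Num.min s (Num.min t k.+1%:R^-1)) => _; split.
  - by rewrite !lt_min s0 t0 invr_gt0 ltr0n.
  - by rewrite !ge_min lexx orbT.
  - by rewrite !ge_min lexx !orbT.
  - by move=> x y z; rewrite !le_min => /andP[xz _] /andP[zy _]; exact: sP zy.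
pose r := fix r k := if k is k'.+1 then g (k', r k') else e.
have r0 k : 0 < r k by elim: k => //= k /(gP (k, _))[].
by exists r => //; split => // k; have [] := gP (k, _) (r0 k).
Qed.

Lemma fast_chain_cvg (r : nat -> R) (x_ : nat -> X) :
  sm_complete d -> fast_radii r ->
  (forall k, d (x_ k) (x_ k.+1) < r k.+2) ->
  exists x, forall k, d (x_ k) x < r k.
Proof.
move=> cd fr xr.
(* Peeling off the first step, not the last, leaves two legs below [r k.+2], which [fast_triangle]
   merges into one below [r k.+1]. The remaining index, from [r k.+1] to [r k], is kept for the
   passage to the limit. *)
have far m k : d (x_ k) (x_ (k + m)%N) < r k.+1.
  elim: m k => [|m IH] k.
    by rewrite addn0 smdistxx (fast_gt0 fr).
  rewrite addnS -addSn.
  by apply: (fast_triangle fr (z := x_ k.+1)); exact: ltW.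
have [x xP] : exists x, sm_converges d x_ x.
  apply: cd => e /(fast_small fr)[k ke]; exists k => n m kn km.
  apply: lt_trans ke; apply: (fast_triangle fr (z := x_ k)).
    by rewrite smdistC -(subnKC kn) ltW.
  by rewrite -(subnKC km) ltW.
exists x => k.
have [N NP] := (sm_convergesP _ _).1 xP _ (fast_gt0 fr k.+1).
apply: (fast_triangle fr (z := x_ (k + N)%N)); first exact/ltW/far.
by apply/ltW/NP; rewrite leq_addl.
Qed.

(** The Kuratowski lower limit, phrased with distances. *)
Definition lower_limit (A : nat -> set X) : set X :=
  [set x | forall e : R, 0 < e -> exists N : nat, forall n, (N <= n)%N ->
    exists2 a, A n a & d x a < e].

(** The Cauchy condition for the Hausdorff distance, read on points. One inclusion is enough, as [n]
    and [m] may be exchanged. *)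
Definition uniformly_cauchy (A : nat -> set X) : Prop :=
  forall e : R, 0 < e -> exists N : nat, forall n m, (N <= n)%N -> (N <= m)%N ->
    forall a, A n a -> exists2 b, A m b & d a b < e.

Lemma lower_limit_closed (A : nat -> set X) :
  small_triangles -> sm_closed d (lower_limit A).
Proof.
move=> st x nAx; apply: contrapT => nball; apply: nAx => e e0.
have [s s0 sP] := st _ e0.
have [y ys Ay] : exists2 y, d y x < s & lower_limit A y.
  apply: contrapT => ny; apply: nball; exists s%:E; first by rewrite lte_fin.
  by move=> y; rewrite /sm_ball /= lte_fin => ys Ay; apply: ny; exists y.
have [N NP] := Ay _ s0; exists N => n /NP[a Aa ya]; exists a => //.
by apply: (sP _ _ y); rewrite ltW // smdistC.
Qed.

Lemma lower_limit_near (A : nat -> set X) (e : R) :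
  small_triangles -> uniformly_cauchy A -> 0 < e ->
  exists N : nat, forall n, (N <= n)%N ->
    forall x, lower_limit A x -> exists2 a, A n a & d x a < e.
Proof.
move=> st uA e0; have [s s0 sP] := st _ e0.
have [N NP] := uA _ s0; exists N => n Nn x Ax.
(* [M] depends on [x] but [N] does not: the detour through the index [maxn M N] makes the final
   threshold uniform in [x]. *)
have [M MP] := Ax _ s0.
have [b Ab xb] := MP _ (leq_maxl M N).
have [a Aa ba] := NP _ _ (leq_maxr M N) Nn _ Ab.
by exists a => //; apply: (sP _ _ b); exact: ltW.
Qed.

Lemma near_lower_limit (A : nat -> set X) (e : R) : sm_complete d ->
  small_triangles -> uniformly_cauchy A -> 0 < e ->
  exists N : nat, forall n, (N <= n)%N ->
    forall a, A n a -> exists2 x, lower_limit A x & d a x < e.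
Proof.
move=> cd st uA e0; have [r fr r0e] := exists_fast_radii st e0.
have [N NP] := choice (fun k => uA _ (fast_gt0 fr k.+2)).
pose M k := (\max_(j < k.+1) N j)%N.
have NM j k : (j <= k)%N -> (N j <= M k)%N.
  move=> jk; have jk1 : (j < k.+1)%N by [].
  by rewrite /M (leq_bigmax (Ordinal jk1)).
exists (N 0%N) => n Nn a Aa.
(* The indices start at [n], since [N 0 <= n], and both [i k] and [i k.+1] lie beyond the threshold
   [N k], so that the [k]-th step can be shorter than [r k.+2]. *)
pose i k := maxn n (M k).
have Ni j k : (j <= k)%N -> (N j <= i k)%N.
  by move=> jk; rewrite leq_max NM ?orbT.
have i0 : i 0%N = n by rewrite /i /M big_ord1; apply/maxn_idPl.
have [||x_ [x0 Ax xr]] := @dependent_chain (A \o i) (fun k => r k.+2) a.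
- by move=> k x /=; apply: NP; exact: Ni.
- by rewrite /= i0.
have [x xP] := fast_chain_cvg cd fr xr.
exists x; last by rewrite -x0 -r0e.
(* The chain only visits the sets of index [i k]; for any other [m] beyond [N k], the Cauchy
   condition moves [x_ k] to a point of [A m]. *)
move=> t t0; have [s s0 sP] := st _ t0.
have [k ks] := fast_small fr s0.
exists (N k) => m Nm.
have [b Ab xb] := NP k _ _ (Ni _ _ (leqnn k)) Nm _ (Ax k).
exists b => //; apply: (sP _ _ (x_ k)).
  by rewrite smdistC; apply/ltW/(lt_trans (xP k)).
by apply/ltW/(lt_trans xb); apply: le_lt_trans ks;
  exact: (fast_mono fr (leqW (leqnSn k))).
Qed.

Lemma sm_bounded_near (Phi : R -> R -> R) (A B : set X) (e : R) :
  triangle_function d Phi -> 0 < e -> sm_bounded d A ->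
  (forall b, B b -> exists2 a, A a & d b a < e) -> sm_bounded d B.
Proof.
move=> tPhi /ltW e0 /sm_bounded_le[M M0 AM] BA.
(* The path from [x] to [y] runs through nearby points [a] and [b] of [A]; the bound is finite
   because [Phi] is real-valued. *)
apply: (@le_lt_trans _ _ (Phi e (Phi M e))%:E); last exact: ltry.
apply: ge_ereal_sup => _ [x [y [/BA[a Aa /ltW xa] /BA[b Ab /ltW yb] ->]]].
rewrite lee_fin; apply: le_trans (triangleP tPhi x y a) _.
apply: (triangle_le tPhi); rewrite ?smdist_ge0 //.
apply: le_trans (triangleP tPhi a y b) _.
by apply: (triangle_le tPhi); rewrite ?smdist_ge0 ?AM // smdistC.
Qed.

End SmallTriangles.

Theorem theorem8 (R : realType) (X : Type) (d : semimetric R X)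
    (Phi : R -> R -> R) (tPhi : triangle_function d Phi)
    (usc : upper_semicontinuous_quadrant Phi)
    (cd : sm_complete d) :
  sm_complete (hausdorff_semimetric tPhi).
Proof.
have st := usc_small_triangles tPhi usc.
move=> A_ cA; pose A n : set X := val (A_ n).
have uA : uniformly_cauchy d A.
  move=> e /cA[N NP]; exists N => n m Nn Nm a; apply: hausdorff_lt_near.
  by rewrite -(EFin_hausdorff_dist tPhi) lte_fin; exact: NP.
have cL : closed_bounded d (lower_limit d A).
  split; last 1 first.
  - have [N NP] := lower_limit_near st uA ltr01.
    have [_ _ bA] := set_valP (A_ N).
    exact: (sm_bounded_near tPhi ltr01 bA (NP _ (leqnn N))).
  - have [N NP] := near_lower_limit cd st uA ltr01.
    have [[a Aa] _ _] := set_valP (A_ N).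
    by have [x Lx _] := NP _ (leqnn N) _ Aa; exists x.
  - exact: lower_limit_closed.
exists (SigSub (mem_set cL)); apply/sm_convergesP => e e0.
have e2 : 0 < e / 2 by rewrite divr_gt0.
have [N NP] := near_lower_limit cd st uA e2.
have [M MP] := lower_limit_near st uA e2.
exists (maxn N M) => n; rewrite geq_max => /andP[Nn Mn].
(* Bounding the infimum gives only a weak inequality, hence the radius [e / 2]. *)
apply: (@le_lt_trans _ _ (e / 2)); last first.
  by rewrite ltr_pdivrMr // ltr_pMr // ltr1n.
rewrite -lee_fin (EFin_hausdorff_dist tPhi).
by apply: hausdorff_le => //; [exact: NP|exact: MP].
Qed.
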